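(* Let $K$ be a complete algebraically closed non-Archimedean field with divisible value group (e.g. $K=\mathbb{C}_p$). Let $(\mathcal{B},\tau,\mathcal{B}')$ be a ball system in $K$, with source balls $B_i=B(a_i,r_i)$ and target balls $B_i'=B(b_i,t_i)$, $1\le i\le N$. Assume that all radii $r_i$ and $t_i$ belong to the value group $|K^\times|$. Then there exists an analytic function $\psi$ defined on the affinoid union $U=\bigcup_{i=1}^N B_i$ that exactly interprets $\tau$, i.e. $\psi(B_i)=B'_{\tau(i)}$ for all $i$. In fact, $\psi$ can be chosen piecewise affine: $$\psi|_{B_i}(z)=b_{\tau(i)}+u_i(z-a_i),\qquad\text{where } u_i\in K,\ |u_i|=\frac{t_{\tau(i)}}{r_i}.$$
   Context: For $a\in K$, $r>0$, $B(a,r)=\{z\in K:|z-a|\le r\}$ is the closed ball. A ball system is a triple $(\mathcal{B},\tau,\mathcal{B}')$ where $\mathcal{B}=\{B_i=B(a_i,r_i)\}_{i=1}^N$ is a finite collection of pairwise disjoint closed balls, $\tau:\{1,\dots,N\}\to\{1,\dots,N\}$ is a map, and $\mathcal{B}'=\{B_i'=B(b_i,t_i)\}_{i=1}^N$ is a family of closed balls (not necessarily disjoint). An analytic function on a finite disjoint union $U$ of closed balls is a function whose restriction to each ball is given by a power series about its center convergent on that ball; different balls may have independent series. A map $\phi$ analytic on $U$ exactly interprets $\tau$ if $\phi(B_i)=B'_{\tau(i)}$ for all $i$. *)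

(* Defs.v *)
From mathcomp Require Import all_boot all_order all_algebra.
From mathcomp Require Import all_classical all_reals all_analysis.

Set Implicit Arguments.
Unset Strict Implicit.
Unset Printing Implicit Defensive.

Import Order.TTheory GRing.Theory Num.Theory.
Import numFieldNormedType.Exports.
Local Open Scope classical_set_scope.
Local Open Scope ring_scope.

(* normedZmodType cannot carry a non-Archimedean absolute value, because it
   requires `|x *+ n| = `|x| *+ n; hence a separate structure. Nontriviality
   of the absolute value is not required. *)
Record nonArchAbs (R : realType) (K : fieldType) := NonArchAbs {
  nabs :> K -> R ;
  nabs_ge0 : forall x : K, 0 <= nabs x ;
  nabs_eq0 : forall x : K, nabs x = 0 <-> x = 0 ;
  nabsM : forall x y : K, nabs (x * y) = nabs x * nabs y ;
  nabs_ultra : forall x y : K, nabs (x + y) <= Num.max (nabs x) (nabs y)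
}.

Definition nabs_cvg (R : realType) (K : fieldType) (v : nonArchAbs R K)
    (s : nat -> K) (l : K) : Prop :=
  (fun n : nat => v (s n - l)) @ \oo --> (0 : R).

Definition nabs_cauchy (R : realType) (K : fieldType) (v : nonArchAbs R K)
    (s : nat -> K) : Prop :=
  forall e : R, 0 < e -> exists M : nat, forall m n : nat,
    (M <= m)%N -> (M <= n)%N -> v (s m - s n) < e.

Definition nabs_complete (R : realType) (K : fieldType) (v : nonArchAbs R K) :
    Prop :=
  forall s : nat -> K, nabs_cauchy v s -> exists l : K, nabs_cvg v s l.

Definition value_group (R : realType) (K : fieldType) (v : nonArchAbs R K) :
    set R :=
  [set v x | x in [set x : K | x != 0]].

Definition divisible_value_group (R : realType) (K : fieldType)
    (v : nonArchAbs R K) : Prop :=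
  forall (g : R) (n : nat), value_group v g -> (0 < n)%N ->
    exists2 h : R, value_group v h & h ^+ n = g.

Definition cball (R : realType) (K : fieldType) (v : nonArchAbs R K)
    (a : K) (r : R) : set K :=
  [set z | v (z - a) <= r].

Record ballSystem (R : realType) (K : fieldType) (v : nonArchAbs R K)
    (N : nat) := BallSystem {
  src_center : 'I_N -> K ;
  src_radius : 'I_N -> R ;
  tgt_center : 'I_N -> K ;
  tgt_radius : 'I_N -> R ;
  tau : 'I_N -> 'I_N ;
  src_radius_gt0 : forall i : 'I_N, 0 < src_radius i ;
  tgt_radius_gt0 : forall i : 'I_N, 0 < tgt_radius i ;
  src_trivIset :
    trivIset setT (fun i : 'I_N => cball v (src_center i) (src_radius i))
}.

Definition src_ball (R : realType) (K : fieldType) (v : nonArchAbs R K)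
    (N : nat) (S : ballSystem v N) (i : 'I_N) : set K :=
  cball v (src_center S i) (src_radius S i).

Definition tgt_ball (R : realType) (K : fieldType) (v : nonArchAbs R K)
    (N : nat) (S : ballSystem v N) (i : 'I_N) : set K :=
  cball v (tgt_center S i) (tgt_radius S i).

(* A function on the union of the source balls is represented by a total
   function K -> K; only its values on that union are ever constrained. *)
Definition analytic_on_sources (R : realType) (K : fieldType)
    (v : nonArchAbs R K) (N : nat) (S : ballSystem v N) (psi : K -> K) :
    Prop :=
  forall i : 'I_N, exists c : nat -> K, forall z : K, src_ball S i z ->
    nabs_cvg v (series (fun k : nat => c k * (z - src_center S i) ^+ k))
      (psi z).

Definition exactly_interprets (R : realType) (K : fieldType)
    (v : nonArchAbs R K) (N : nat) (S : ballSystem v N) (psi : K -> K) :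
    Prop :=
  forall i : 'I_N, psi @` src_ball S i = tgt_ball S (tau S i).

(* Main.v *)
Require Import Defs.
From mathcomp Require Import all_boot all_order all_algebra.
From mathcomp Require Import all_classical all_reals all_analysis.

Set Implicit Arguments.
Unset Strict Implicit.
Unset Printing Implicit Defensive.

Import Order.TTheory GRing.Theory Num.Theory.
Import numFieldNormedType.Exports.
Local Open Scope classical_set_scope.
Local Open Scope ring_scope.

(** An affine map [z |-> b + u * (z - a)] with [u != 0] multiplies distances by
    [v u], and its inverse is affine too, so it carries the closed ball of
    radius [r] about [a] onto the closed ball of radius [v u * r] about [b]
    ([affine_image_cball]).  It therefore suffices to find slopes of absolute
    value [t / r], which exist because the value group is closed under
    quotients ([value_group_div]).  The source balls are pairwise disjoint, so
    the affine maps chosen on each of them glue to a single function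
    ([glue_on_trivIset]), and an affine map is its own, eventually vanishing,
    power series at the center ([affine_series]). *)

Lemma nabs0 (R : realType) (K : fieldType) (v : nonArchAbs R K) : v 0 = 0.
Proof. exact/nabs_eq0. Qed.

Lemma nabs_gt0 (R : realType) (K : fieldType) (v : nonArchAbs R K) (x : K) :
  x != 0 -> 0 < v x.
Proof.
move=> x0; rewrite lt_def nabs_ge0 andbT.
by apply: contra_neq x0 => /nabs_eq0.
Qed.

Lemma value_group_div (R : realType) (K : fieldType) (v : nonArchAbs R K)
    (g h : R) :
  value_group v g -> value_group v h ->
  exists2 u : K, u != 0 & v u = g / h.
Proof.
move=> [x /= x0 <-] [y /= y0 <-]; exists (x / y).
  by rewrite mulf_neq0 ?invr_neq0.
apply: (mulIf (lt0r_neq0 (nabs_gt0 v y0))).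
by rewrite -nabsM !divfK // lt0r_neq0 ?nabs_gt0.
Qed.

Lemma affine_image_cball (R : realType) (K : fieldType) (v : nonArchAbs R K)
    (a b u : K) (r : R) : u != 0 ->
  (fun z => b + u * (z - a)) @` cball v a r = cball v b (v u * r).
Proof.
move=> u0; have vu0 := nabs_gt0 v u0.
rewrite /cball; apply/seteqP; split => [_ [z /= zr <-]|w /= wr].
  by rewrite addrC addKr nabsM ler_pM2l.
exists (a + (w - b) / u); rewrite /= (addrC a) addrK; last first.
  by rewrite mulrC divfK // addrC subrK.
by rewrite -(ler_pM2l vu0) -nabsM mulrC divfK.
Qed.

Lemma nabs_cvg_eventually_cst (R : realType) (K : fieldType)
    (v : nonArchAbs R K) (s : nat -> K) (l : K) (M : nat) :
  (forall n : nat, (M <= n)%N -> s n = l) -> nabs_cvg v s l.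
Proof.
move=> sl; apply: cvg_near_cst; exists M => // n /= Mn.
by rewrite sl // subrr nabs0.
Qed.

Definition affine_coef (K : fieldType) (b u : K) (k : nat) : K :=
  [:: b; u]`_k.

Lemma affine_series (K : fieldType) (b u x : K) (n : nat) : (2 <= n)%N ->
  series (fun k : nat => affine_coef b u k * x ^+ k) n = b + u * x.
Proof.
case: n => [|[|n]] // _; rewrite /series /=.
rewrite !big_nat_recl // big1 => [|k _]; last first.
  by rewrite /affine_coef /= nth_nil mul0r.
by rewrite /= expr0 mulr1 expr1 addr0.
Qed.

(** Disjointness makes the index of the piece containing a point unique, so
    any choice of such an index gives the same value. *)
Lemma glue_on_trivIset (I : finType) (T U : Type) (y0 : U)
    (A : I -> set T) (f : I -> T -> U) : trivIset setT A ->
  exists g : T -> U, forall (i : I) (z : T), A i z -> g z = f i z.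
Proof.
move=> disjA.
exists (fun z => if [pick i | `[< A i z >]] is Some i then f i z else y0).
move=> i z Aiz; case: pickP => [j /asboolP Ajz|/(_ i)/asboolP//].
by rewrite (disjA i j) //; exists z.
Qed.

Theorem theorem5p2 (R : realType) (K : closedFieldType) (v : nonArchAbs R K)
    (hcomplete : nabs_complete v)
    (hdiv : divisible_value_group v)
    (N : nat) (S : ballSystem v N)
    (hsrc : forall i : 'I_N, value_group v (src_radius S i))
    (htgt : forall i : 'I_N, value_group v (tgt_radius S i)) :
  exists psi : K -> K,
    [/\ analytic_on_sources S psi,
        exactly_interprets S psi &
        exists u : 'I_N -> K, forall i : 'I_N,
          v (u i) = tgt_radius S (tau S i) / src_radius S i /\
          (forall z : K, src_ball S i z ->
             psi z = tgt_center S (tau S i) + u i * (z - src_center S i))].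
Proof.
have /choice[u uP] : forall i : 'I_N, exists w : K,
    w != 0 /\ v w = tgt_radius S (tau S i) / src_radius S i.
  by move=> i; have [w] := value_group_div (htgt (tau S i)) (hsrc i); exists w.
have [psi psiE] := glue_on_trivIset 0
  (fun i z => tgt_center S (tau S i) + u i * (z - src_center S i))
  (@src_trivIset _ _ _ _ S).
exists psi; split => [i|i|].
- exists (affine_coef (tgt_center S (tau S i)) (u i)) => z iz.
  apply: (@nabs_cvg_eventually_cst _ _ _ _ _ 2) => n n2.
  by rewrite affine_series // (psiE i).
- have [u0 vu] := uP i.
  have r0 : src_radius S i != 0 by rewrite lt0r_neq0 ?src_radius_gt0.
  rewrite (eq_imagel (psiE i)) (affine_image_cball v _ _ _ u0).
  by rewrite vu divfK.
- by exists u => i; have [_ vu] := uP i; split=> // z; exact: psiE.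
Qed.
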